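(* Let $(T,X)$ and $(T,Y)$ be distal minimal semiflows on compact Hausdorff spaces and let $\pi:(T,X)\to(T,Y)$ be an epimorphism. Then there is a projective system of minimal semiflows $\{(T,X_\lambda)\,|\,\lambda\le\theta\}$, for some ordinal $\theta\ge1$, with $X_\theta=X$ and $X_0=Y$, such that if $0\le\lambda<\theta$, then $\pi^{\lambda+1}_\lambda:(T,X_{\lambda+1})\to(T,X_\lambda)$ is a relatively equicontinuous extension.
   Context: $T$ is a discrete semigroup with identity $e$ and all phase spaces are nonempty compact Hausdorff. A semiflow $(T,X)$ is a continuous map $T\times X\to X$, $(t,x)\mapsto tx$, with $ex=x$ and $t(sx)=(ts)x$. It is minimal if $Tx$ is dense in $X$ for every $x$; distal if for all $x\ne y$ there is an entourage $\alpha$ of the compatible uniformity with $(tx,ty)\notin\alpha$ for all $t\in T$. An epimorphism $\varphi:(T,X)\to(T,Y)$ is a continuous surjection with $\varphi(tx)=t\varphi(x)$. An epimorphism $\varphi$ is a relatively equicontinuous extension if for every entourage $\varepsilon$ of $X$ there is an entourage $\delta$ of $X$ such that $(x,x')\in\delta$ and $\varphi(x)=\varphi(x')$ imply $(tx,tx')\in\varepsilon$ for all $t\in T$. A projective system of minimal semiflows with phase semigroup $T$ is a collection of minimal semiflows $(T,X_\lambda)$ indexed by ordinals $\lambda\le\theta$ and epimorphisms $\pi^\lambda_\nu:(T,X_\lambda)\to(T,X_\nu)$ for $0\le\nu<\lambda\le\theta$ such that: (i) if $0\le\nu<\lambda<\eta\le\theta$ then $\pi^\eta_\nu=\pi^\lambda_\nu\circ\pi^\eta_\lambda$;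 (ii) if $\mu\le\theta$ is a limit ordinal, then $X_\mu$ is the minimal subset of the product semiflow $(T,\prod_{\lambda<\mu}X_\lambda)$ consisting of all $(x_\lambda)_{\lambda<\mu}$ with $x_\nu=\pi^\lambda_\nu(x_\lambda)$ for all $\nu<\lambda<\mu$, and $\pi^\mu_\lambda$ is the projection map (i.e. $(T,X_\mu)$ is the inverse limit of $\{(T,X_\lambda)\}_{\lambda<\mu}$). *)

(* Defs.v *)
From mathcomp Require Import all_boot all_order.
From mathcomp Require Import all_classical topology.

Set Implicit Arguments.
Unset Strict Implicit.
Unset Printing Implicit Defensive.

Local Open Scope classical_set_scope.

Definition homeomorphism (X Y : topologicalType) (h : X -> Y) : Prop :=
  continuous h /\
  exists g : Y -> X, [/\ continuous g, cancel h g & cancel g h].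

(** A compact Hausdorff space carries exactly one uniformity compatible with
    its topology, so a [uniformType] is a topological space together with it. *)
Record semiflow (T : monoidType) := Semiflow {
  phase :> uniformType;
  act : T -> phase -> phase;
  phase_nonempty : [set: phase] !=set0;
  phase_compact : compact [set: phase];
  phase_hausdorff : hausdorff_space phase;
  act_continuous :
    continuous (fun p : discrete_topology T * phase => act p.1 p.2);
  act1 : forall x, act 1%g x = x;
  actM : forall t s x, act t (act s x) = act (t * s)%g x
}.

Section Semiflows.
Context {T : monoidType}.
Implicit Types X Y : semiflow T.

Definition minimal_semiflow X : Prop :=
  forall x : X, dense (range (fun t : T => act t x)).

Definition distal X : Prop :=
  forall x y : X, x <> y ->
    exists2 alpha, entourage alpha & forall t : T, ~ alpha (act t x, act t y).

Definition equivariant X Y (phi : X -> Y) : Prop :=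
  forall (t : T) (x : X), phi (act t x) = act t (phi x).

Definition epimorphism X Y (phi : X -> Y) : Prop :=
  [/\ continuous phi, (forall y, exists x, phi x = y) & equivariant phi].

Definition isomorphism X Y (phi : X -> Y) : Prop :=
  homeomorphism phi /\ equivariant phi.

Definition relatively_equicontinuous X Y (phi : X -> Y) : Prop :=
  forall eps : set (X * X), entourage eps ->
    exists2 delta : set (X * X), entourage delta &
      forall x x' : X, delta (x, x') -> phi x = phi x' ->
        forall t : T, eps (act t x, act t x').

End Semiflows.

(** An ordinal [theta] is encoded by a well-order [I] isomorphic to the set of
    ordinals [la <= theta]: the least element [\bot] stands for [0] and the
    greatest element [\top] for [theta]. *)
Section OrdinalIndices.
Context {d : Order.disp_t} {I : tbOrderType d}.

Definition is_successor (la la' : I) : Prop :=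
  (la < la')%O /\ forall k : I, (la < k)%O -> (la' <= k)%O.

Definition is_limit (mu : I) : Prop :=
  mu <> \bot%O /\ ~ exists la : I, is_successor la mu.

End OrdinalIndices.

Section InverseLimit.
Context {T : monoidType} {d : Order.disp_t} {I : tbOrderType d}.
Variables (X : I -> semiflow T)
          (p : forall nu la : I, (nu < la)%O -> X la -> X nu) (mu : I).

Definition below : Type := {la : I | (la < mu)%O}.

Definition product_below : uniformType :=
  prod_topology (fun la : below => X (sval la)).

Definition product_act (t : T) (x : product_below) : product_below :=
  fun la => act t (x la).

Definition threads : set product_below :=
  [set x | forall (nu la : below) (h : (sval nu < sval la)%O),
             x nu = p h (x la)].

(** [X mu] is identified with [threads], with the subspace topology and the
    coordinatewise action, in such a way that [p^mu_la] becomes the projection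
    to the coordinate [la]. *)
Definition is_inverse_limit : Prop :=
  exists h : X mu -> threads,
    [/\ homeomorphism h,
        forall t x, set_val (h (act t x)) = product_act t (set_val (h x)) &
        forall x (la : below), set_val (h x) la = p (svalP la) x].

End InverseLimit.

Record projective_system (T : monoidType) (d : Order.disp_t)
    (I : tbOrderType d) := ProjectiveSystem {
  stage :> I -> semiflow T;
  bond : forall nu la : I, (nu < la)%O -> stage la -> stage nu;
  stage_minimal : forall la, minimal_semiflow (stage la);
  bond_epimorphism :
    forall (nu la : I) (h : (nu < la)%O), epimorphism (bond h);
  bond_comp :
    forall (nu la eta : I) (h1 : (nu < la)%O) (h2 : (la < eta)%O)
           (h3 : (nu < eta)%O) (x : stage eta),
      bond h3 x = bond h1 (bond h2 x);
  bond_limit : forall mu : I, is_limit mu -> is_inverse_limit bond mu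
}.

(* Main.v *)
Require Import Defs.
From HB Require Import structures.
From mathcomp Require Import all_boot all_order.
From mathcomp Require Import all_classical wochoice topology.
Import Order.TTheory.

(** Let [G] be the closure of [T] in [X ^ X].  Distality makes [G] a group
    (Ellis: a compact right topological semigroup contains an idempotent, and an
    injective idempotent is the identity), and minimality makes it transitive
    on [X].  Give [G] the sigma-topology, the quotient topology under
    [(g, h) |-> g^-1 h].  For a closed invariant equivalence relation [R] on
    [X], let [L] be the set of the [a] in [G] with [R (x0, a x0)], and let [N]
    be the set of the elements of [L] that are not separated from [1] in the
    sigma-topology of [L].  Then [N] is a normal subgroup of [L], its relation
    [{(g x0, g n x0)}] is a closed invariant equivalence relation [R'], and
    [X / R' -> X / R] is relatively equicontinuous because [L / N] is Hausdorff.
    If [R' = R], then the pairs of [R] that some [t] moves into a prescribed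
    neighbourhood of the diagonal are dense in [R]; a Baire category argument
    along a sequence of times, which needs no metrizability of [X], then gives a
    contradiction with distality unless [R] is the diagonal.  Iterating
    [R |-> R'] transfinitely from the kernel of [p] therefore ends at the
    diagonal. *)

Set Implicit Arguments.
Unset Strict Implicit.
Unset Printing Implicit Defensive.

Local Open Scope classical_set_scope.

(** * Topological preliminaries *)

Lemma prod_topology_continuous (Z : topologicalType) (I : Type)
    (K : I -> topologicalType) (F : Z -> prod_topology K) :
  (forall i, continuous (fun z => F z i)) -> continuous F.
Proof.
move=> cF z; apply/cvg_sup => i U [V [[W oW <-] /= WF] VU].
apply: (filterS VU); apply: cF; exact: open_nbhs_nbhs.
Qed.

Lemma prod_eval_continuous (I : Type) (K : I -> topologicalType) (i : I) :
  continuous (fun f : prod_topology K => f i).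
Proof. exact: (@proj_continuous {classic I} K i). Qed.

Lemma compact_prodT (I : Type) (K : I -> topologicalType) :
  (forall i, compact [set: K i]) -> compact [set: prod_topology K].
Proof.
move=> cK; have := @tychonoff {classic I} K (fun i => setT) cK.
by congr compact; apply/seteqP; split.
Qed.

Lemma hausdorff_prodT (I : Type) (K : I -> topologicalType) :
  (forall i, hausdorff_space (K i)) -> hausdorff_space (prod_topology K).
Proof. exact: (@hausdorff_product {classic I} K). Qed.

Lemma image_closed (Z W : topologicalType) (f : Z -> W) (A : set Z) :
  compact [set: Z] -> hausdorff_space W -> continuous f -> closed A ->
  closed (f @` A).
Proof.
move=> cZ hW cf cA; apply: compact_closed => //.
apply: continuous_compact; first exact: continuous_subspaceT.
exact: subclosed_compact cZ _.
Qed.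

Lemma closure_imageS (Z W : topologicalType) (f : Z -> W) (A : set Z) :
  compact [set: Z] -> hausdorff_space W -> continuous f ->
  closure (f @` A) `<=` f @` closure A.
Proof.
move=> cZ hW cf; rewrite closureE; apply: smallest_sub.
  by apply: image_closed => //; exact: closed_closure.
by apply: image_subset; exact: subset_closure.
Qed.

Lemma cancel_continuous (Z W : topologicalType) (f : Z -> W) (g : W -> Z) :
  compact [set: Z] -> hausdorff_space W -> continuous f ->
  cancel f g -> cancel g f -> continuous g.
Proof.
move=> cZ hW cf fK gK; apply/continuous_closedP => A cA.
rewrite (_ : g @^-1` A = f @` A); first exact: image_closed.
apply/seteqP; split => [w Aw|_ [z Az <-]]; last by rewrite /= fK.
by exists (g w) => //; rewrite gK.
Qed.

Lemma pair_continuous (Z U V : topologicalType) (f : Z -> U) (g : Z -> V) :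
  continuous f -> continuous g -> continuous (fun z => (f z, g z)).
Proof. by move=> cf cg z; apply: cvg_pair; [apply: cf|apply: cg]. Qed.

Lemma map_pair_continuous (U V U' V' : topologicalType) (f : U -> U')
    (g : V -> V') : continuous f -> continuous g ->
  continuous (fun z : U * V => (f z.1, g z.2)).
Proof.
move=> cf cg; apply: pair_continuous => z; apply: continuous_comp.
- exact: cvg_fst.
- exact: cf.
- exact: cvg_snd.
- exact: cg.
Qed.

Lemma compact_pairT (U V : topologicalType) :
  compact [set: U] -> compact [set: V] -> compact [set: U * V].
Proof. by move=> cU cV; rewrite -setXTT; exact: compact_setX. Qed.

Lemma fst_continuous (U V : topologicalType) : continuous (@fst U V).
Proof. by move=> z; exact: cvg_fst. Qed.

Lemma snd_continuous (U V : topologicalType) : continuous (@snd U V).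
Proof. by move=> z; exact: cvg_snd. Qed.

Lemma hausdorff_pair (U V : topologicalType) :
  hausdorff_space U -> hausdorff_space V -> hausdorff_space (U * V)%type.
Proof.
move=> hU hV [u v] [u' v'] /= uv; congr (_, _).
  apply: hU => A B Au Bu'.
  have [z [Az Bz]] := uv _ _ (fst_continuous (x := (u, v)) Au)
    (fst_continuous (x := (u', v')) Bu').
  by exists z.1.
apply: hV => A B Av Bv'.
have [z [Az Bz]] := uv _ _ (snd_continuous (x := (u, v)) Av)
  (snd_continuous (x := (u', v')) Bv').
by exists z.2.
Qed.

(** The chain is a filter base, and a cluster point of it lies in each member because the members
    are closed. *)
Lemma compact_chain_inter (Z : topologicalType) (A : set (set Z)) :
  compact [set: Z] -> A !=set0 -> total_on A (fun B C => B `<=` C) ->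
  (forall B, A B -> closed B) -> (forall B, A B -> B !=set0) ->
  exists z, forall B, A B -> B z.
Proof.
move=> cZ A0 totA clA neA.
have FF : Filter (filter_from A id).
  apply: filter_from_filter => // B C AB AC.
  by case: (totA B C AB AC) => BC; [exists B|exists C] => // z Bz; split => //;
    apply: BC.
have PF : ProperFilter (filter_from A id) by exact: filter_from_proper.
have [z [_]] := cZ _ PF filterT; rewrite clusterE => zA.
exists z => B AB; rewrite (closure_id B).1; last exact: clA.
by apply: zA; exists B.
Qed.

(** * Compact semigroups of self-maps *)

Section SelfMaps.
Context {X : topologicalType}.
Hypotheses (cX : compact [set: X]) (hX : hausdorff_space X).
Local Notation W := {ptws X -> X}.

Definition comp_closed (P : set W) := forall f g, P f -> P g -> P (f \o g).

(** Composition is continuous in its left factor for every right factor; in the right factor this is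
    ensured only when the left one is continuous. Hence the semigroup arguments below translate on
    the right. *)
Lemma precomp_continuous (g : W) : continuous (fun f : W => f \o g : W).
Proof.
apply: prod_topology_continuous => x.
exact: (@prod_eval_continuous X (fun=> X) (g x)).
Qed.

Lemma postcomp_continuous (f : W) :
  continuous (f : X -> X) -> continuous (fun g : W => f \o g : W).
Proof.
move=> cf; apply: prod_topology_continuous => x g.
apply: (@continuous_comp _ _ _ (fun g : W => g x) f); last exact: cf.
exact: (@prod_eval_continuous X (fun=> X) x).
Qed.

Lemma compact_selfmaps : compact [set: W].
Proof. exact: compact_prodT. Qed.

Lemma hausdorff_selfmaps : hausdorff_space W.
Proof. exact: hausdorff_prodT. Qed.

Lemma closed_eq_selfmap (F : W -> W) (g : W) :
  continuous F -> closed [set f | F f = g].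
Proof.
move=> cF; apply: (@preimage_closed _ _ F [set g]).
  by move=> ? _; exact: cF.
apply: accessible_closed_set1; apply: hausdorff_accessible.
exact: hausdorff_selfmaps.
Qed.

(** Zorn's lemma gives a minimal closed subsemigroup [M]. For [a] in [M], minimality forces
    [M a = M], so the closed subsemigroup of the [f] in [M] with [f \o a = a] is nonempty and equals
    [M]; thus [a] is idempotent. *)
Lemma ellis_numakura (P : set W) :
  closed P -> P !=set0 -> comp_closed P -> exists2 u, P u & u \o u = u.
Proof.
move=> clP P0 compP.
pose good (M : set W) := [/\ closed M, M !=set0, comp_closed M & M `<=` P].
pose R (M N : {M | good M}) := `[< sval N `<=` sval M >].
have [||//||[M gM] maxM] := @Zorn _ R.
- by move=> M; apply/asboolP.
- by move=> M N L /asboolP MN /asboolP NL; apply/asboolP; exact: subset_trans MN.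
- move=> [M gM] [N gN] /asboolP MN /asboolP NM.
  have e : M = N by apply/seteqP.
  by subst N; congr exist; exact: Prop_irrelevance.
- move=> A totA; have [A0|/set0P/negP/negPn/eqP A0] := pselect (A !=set0); last first.
    by exists (exist _ P (And4 clP P0 compP (@subset_refl _ P))) => M; rewrite A0.
  have gA : good (\bigcap_(M in A) sval M).
    split.
    + by apply: closed_bigI => M _; case: (svalP M).
    + have [|||||z zA] := @compact_chain_inter W (sval @` A).
      * exact: compact_selfmaps.
      * by case: A0 => M AM; exists (sval M); exists M.
      * move=> _ _ [M AM <-] [N AN <-].
        by case: (totA M N AM AN) => /asboolP; [right|left].
      * by move=> _ [M _ <-]; case: (svalP M).
      * by move=> _ [M _ <-]; case: (svalP M).
      * by exists z => M AM; apply: zA; exists M.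
    + move=> f g Af Ag M AM; case: (svalP M) => _ _ cM _.
      by apply: cM; [apply: Af|apply: Ag].
    + by case: A0 => M AM f /(_ _ AM); case: (svalP M) => _ _ _; apply.
  by exists (exist _ _ gA) => M AM; apply/asboolP => /= f; apply.
have {}maxM N : good N -> N `<=` M -> N = M.
  by move=> gN NM; have /(congr1 sval) := maxM (exist _ N gN) (asboolT NM).
case: gM => clM [a Ma] compM MP.
have Ma_eq : [set f \o a | f in M] = M :> set W.
  apply: maxM; last by move=> _ [f Mf <-]; exact: compM.
  split.
  - apply: image_closed => //; [exact: compact_selfmaps|exact: hausdorff_selfmaps|].
    exact: precomp_continuous.
  - by exists (a \o a); exists a.
  - move=> _ _ [f Mf <-] [g Mg <-]; exists (f \o a \o g) => //.
    by apply: (compM) => //; exact: compM.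
  - by move=> _ [f Mf <-]; apply/MP/compM.
have Mfix : M `&` [set f : W | f \o a = a] = M.
  apply: maxM; last exact: subIsetl.
  split.
  - by apply: closedI => //; apply: closed_eq_selfmap; exact: precomp_continuous.
  - by move: Ma; rewrite -{1}Ma_eq => -[f Mf fa]; exists f.
  - move=> f g [Mf fa] [Mg ga]; split; first exact: compM.
    by rewrite /= -compA ga.
  - by move=> f [/MP].
exists a; first exact: MP.
by move: Ma; rewrite -{1}Mfix => -[].
Qed.

(** An injective idempotent is the identity: cancel [u] in [u (u x) = u x]. *)
Lemma comp_closed_id (P : set W) : closed P -> P !=set0 -> comp_closed P ->
  (forall f, P f -> injective f) -> P id.
Proof.
move=> clP P0 compP injP; have [u Pu uu] := ellis_numakura clP P0 compP.
suff <- : u = id by [].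
by apply/funext => x; apply: (injP _ Pu); exact: (congr1 (@^~ x) uu).
Qed.

(** The left ideal [P f] is again a closed semigroup of injective maps, so it contains the
    identity. *)
Lemma comp_closed_linv (P : set W) : closed P -> comp_closed P ->
  (forall f, P f -> injective f) ->
  forall f, P f -> exists2 g, P g & g \o f = id.
Proof.
move=> clP compP injP f Pf.
have [] : [set g \o f | g in P] (id : W); last by move=> g; exists g.
apply: comp_closed_id.
- apply: image_closed => //; [exact: compact_selfmaps|exact: hausdorff_selfmaps|].
  exact: precomp_continuous.
- by exists (f \o f); exists f.
- move=> _ _ [g Pg <-] [h Ph <-]; exists (g \o f \o h) => //.
  by apply: (compP) => //; exact: compP.
- by move=> _ [g Pg <-]; apply: injP; exact: compP.
Qed.

(** The right factor passes to the limit first, while the left one is still in [S] and so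
    continuous; the left factor follows by continuity of right translation. *)
Lemma closure_comp_closed (S : set W) :
  (forall f, S f -> continuous (f : X -> X)) -> comp_closed S ->
  comp_closed (closure S).
Proof.
move=> cS compS.
have SclS f g : S f -> closure S g -> closure S (f \o g).
  move=> Sf; suff : closure S `<=` [set g : W | closure S (f \o g)] by apply.
  rewrite [X in X `<=` _]closureE; apply: smallest_sub.
    apply: (@preimage_closed _ _ (fun g : W => f \o g : W)).
      by move=> ? _; apply: postcomp_continuous; exact: cS.
    exact: closed_closure.
  by move=> h Sh; apply: subset_closure; exact: compS.
move=> f g + Sg; suff : closure S `<=` [set f : W | closure S (f \o g)] by apply.
rewrite [X in X `<=` _]closureE; apply: smallest_sub.
  apply: (@preimage_closed _ _ (fun f : W => f \o g : W)).
    by move=> ? _; exact: precomp_continuous.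
  exact: closed_closure.
by move=> h Sh; exact: SclS.
Qed.

End SelfMaps.

(** * Almost proximal pairs in distal semiflows *)

Lemma closed_diagonal (Z : topologicalType) :
  hausdorff_space Z -> closed [set z : Z * Z | z.1 = z.2].
Proof.
move=> hZ [x y] /= xy; apply: hZ => A B Ax By.
have [|[u v] [/= -> [Av Bv]]] := xy (A `*` B); last by exists v.
by exists (A, B).
Qed.

Section Enveloping.
Context {T : monoidType} {X : semiflow T}.
Local Notation W := {ptws X -> X}.

Definition translations (S : set T) : set W := [set (act t : X -> X) | t in S].

Definition enveloping : set W := closure (translations setT).

Lemma act_cont (t : T) : continuous (act t : X -> X).
Proof.
have ct : continuous (fun x : X => (t : discrete_topology T, x)).
  by apply: pair_continuous => x; [exact: cvg_cst|exact: cvg_id].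
by move=> x; apply: continuous_comp (ct x) (@act_continuous T X (t, x)).
Qed.

Definition act2 (t : T) (z : X * X) : X * X := (act t z.1, act t z.2).

Lemma act2_continuous t : continuous (act2 t).
Proof. by apply: map_pair_continuous; exact: act_cont. Qed.

Lemma eval2_continuous (z : X * X) : continuous (fun g : W => (g z.1, g z.2)).
Proof.
by apply: pair_continuous; exact: (@prod_eval_continuous X (fun=> X)).
Qed.

Lemma translations_comp_closed (S : set T) :
  (forall s t, S s -> S t -> S (s * t)%g) -> comp_closed (translations S).
Proof.
move=> mulS _ _ [s Ss <-] [t St <-]; exists (s * t)%g; first exact: mulS.
by apply/funext => x; rewrite /= actM.
Qed.

Lemma closure_translations_comp (S : set T) :
  (forall s t, S s -> S t -> S (s * t)%g) ->
  comp_closed (closure (translations S)).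
Proof.
move=> mulS; apply: closure_comp_closed; last exact: translations_comp_closed.
by move=> _ [t _ <-]; exact: act_cont.
Qed.

Lemma enveloping_comp : comp_closed enveloping.
Proof. exact: closure_translations_comp. Qed.

(** If [f x = f y], a translation close to [f] at both points brings [x] and [y] closer than
    distality permits. *)
Lemma enveloping_injective (f : W) : distal X -> enveloping f -> injective f.
Proof.
move=> dX Ef x y fxy; apply: contrapT => /dX[al ental naxy].
pose b := split_ent al `&` (split_ent al)^-1%relation.
have entb : entourage b by exact: entourage_invI.
have [|_ [[t _ <-] [/= /xsectionP[_ tx] /xsectionP[ty _]]]] :=
    Ef [set g | xsection b (f x) (g x) /\ xsection b (f y) (g y)].
  by apply: filterI; apply: (@prod_eval_continuous X (fun=> X));
    exact: nbhs_entourage.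
apply: (naxy t); apply: (entourage_split (f x)) => //.
by rewrite fxy.
Qed.

Lemma act2_preimage_open (A : set (X * X)) (F : seq T) : open A ->
  open [set z | forall s, s \in F -> A (act2 s z)].
Proof.
move=> oA; elim: F => [|s F IH].
  rewrite (_ : mkset _ = setT); first exact: openT.
  by apply/seteqP; split.
rewrite (_ : mkset _ = act2 s @^-1` A `&`
    [set z | forall s, s \in F -> A (act2 s z)]).
  apply: openI => //; move/continuousP: (act2_continuous (t := s)); exact.
apply/seteqP; split => z /= Az.
  by split => [|u uF]; apply: Az; rewrite in_cons ?eqxx// uF orbT.
by move=> u; rewrite in_cons => /orP[/eqP ->|]; [case: Az|case: Az => _; apply].
Qed.

Lemma open_separated_from_diagonal (z : X * X) : z.1 <> z.2 ->
  exists O A : set (X * X), [/\ open O, O z, open A,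
    (forall x, A (x, x)) & forall w, closure A w -> ~ O w].
Proof.
move=> nz; have od : open (~` [set w : X * X | w.1 = w.2]).
  by apply: closed_openC; apply: closed_diagonal; exact: phase_hausdorff.
have [B Bz BD] := @uniform_regular (X * X)%type z _ (open_nbhs_nbhs (conj od nz)).
exists B°, (~` closure B); split.
- exact: open_interior.
- exact: Bz.
- by apply: closed_openC; exact: closed_closure.
- by move=> x /BD /=.
- move=> w Aw Bw; have [u [nBu Bu]] := Aw _ Bw.
  exact/nBu/subset_closure.
Qed.

Lemma open_shrink (z : X * X) (O : set (X * X)) : open O -> O z ->
  exists O', [/\ open O', O' z & closure O' `<=` O].
Proof.
move=> oO Oz.
have [B Bz BO] := @uniform_regular (X * X)%type z _ (open_nbhs_nbhs (conj oO Oz)).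
exists B°; split; [exact: open_interior|exact: Bz|].
by apply: subset_trans BO; apply: closure_subset; exact: interior_subset.
Qed.

(** Adjoining all pairwise products at each step makes the union of the lists closed under
    multiplication. *)
Definition word_step (F : seq T) (t : T) : seq T :=
  (t :: F) ++ [seq (a * b)%g | a <- t :: F, b <- t :: F].

(* The times [t_n] with [act2 t_n z] close to the diagonal are chosen along a
   sequence, and closeness is required to persist under the countable
   semigroup [S] they generate.  A cluster point [p] of the [t_n] then makes
   [(p x, p y)] invariantly close; as [closure S] is a group of bijections, the
   same holds for [z]. *)
Theorem distal_dense_diagonal (R : set (X * X)) : distal X -> closed R ->
  (forall A O : set (X * X), open A -> (forall x, A (x, x)) -> open O ->
     O `&` R !=set0 ->
     exists z t, [/\ O z, R z & A (act2 t z)]) ->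
  forall x y, R (x, y) -> x = y.
Proof.
move=> dX clR denseR x0 y0 Rxy; apply: contrapT => nxy.
have [O0 [A [oO0 O0z oA Adiag clA]]] := @open_separated_from_diagonal (x0, y0) nxy.
(* A state is a finite list of times with an open set meeting [R]. The next time [t] and the smaller
   open set are chosen so that every listed [u] sends [act2 t z] into [A] for all [z] in the new
   set. *)
pose good (s : seq T * set (X * X)) := open s.2 /\ s.2 `&` R !=set0.
pose next (s s' : {s | good s}) := exists t,
  [/\ (sval s').1 = word_step (sval s).1 t,
      closure (sval s').2 `<=` (sval s).2 &
      forall z u, (sval s').2 z -> u \in (sval s).1 -> A (act2 u (act2 t z))].
have ex_next s : {s' | next s s'}.
  apply: cid; case: s => -[F O] [/= oO OR].
  have [|||z [t [Oz Rz At]]] := denseR _ O (act2_preimage_open (F := F) oA).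
  - by move=> x s _; exact: Adiag.
  - by [].
  - exact: OR.
  have oN : open (O `&` act2 t @^-1` [set z | forall s, s \in F -> A (act2 s z)]).
    apply: openI => //; have /continuousP := act2_continuous (t := t); apply.
    exact: act2_preimage_open.
  have [O' [oO' O'z O'N]] := open_shrink oN (conj Oz At).
  have gs' : good (word_step F t, O') by split => //; exists z.
  exists (exist _ _ gs'), t; split => //=.
    by move=> w /O'N [].
  by move=> w u O'w uF; have [_] := O'N _ (subset_closure O'w); exact.
have g0 : good ([::], O0) by split => //; exists (x0, y0).
have [f [f0 fS]] := dependent_choice ex_next (exist _ _ g0).
pose F n := (sval (f n)).1; pose O n := (sval (f n)).2.
have [t tP] := @choice nat T (fun n t => [/\ F n.+1 = word_step (F n) t,
    closure (O n.+1) `<=` O n &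
    forall z u, O n.+1 z -> u \in F n -> A (act2 u (act2 t z))]) fS.
have decO m n : (m <= n)%N -> O n `<=` O m.
  elim: n => [|n IH]; first by rewrite leqn0 => /eqP ->.
  rewrite leq_eqVlt => /orP[/eqP -> //|/IH]; apply: subset_trans.
  have [_ clO _] := tP n; apply: subset_trans clO; exact: subset_closure.
have incF m n : (m <= n)%N -> {subset F m <= F n}.
  elim: n => [|n IH]; first by rewrite leqn0 => /eqP ->.
  rewrite leq_eqVlt => /orP[/eqP -> //|/IH FF] u /FF uF.
  by have [-> _ _] := tP n; rewrite /word_step mem_cat in_cons uF orbT.
have [z zO] : exists z, forall n, O n z /\ R z.
  have [|||||z zO] := @compact_chain_inter _
    [set closure (O n) `&` R | n in [set: nat]].
  - by apply: compact_pairT; exact: phase_compact.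
  - by exists (closure (O 0%N) `&` R), 0%N.
  - move=> _ _ [m _ <-] [n _ <-]; case: (leqP m n) => [|/ltnW] mn.
      by right; apply: setSI; exact/closure_subset/decO.
    by left; apply: setSI; exact/closure_subset/decO.
  - by move=> _ [n _ <-]; apply: closedI => //; exact: closed_closure.
  - move=> _ [n _ <-]; have [_ [z [Oz Rz]]] := svalP (f n).
    by exists z; split => //; exact: subset_closure.
  exists z => n; have [|cz Rz] := zO (closure (O n.+1) `&` R); first by exists n.+1.
  by split => //; have [_ clO _] := tP n; exact: clO.
pose S := [set s | exists n, s \in F n].
have St n : S (t n).
  by exists n.+1; have [-> _ _] := tP n; rewrite mem_cat in_cons eqxx.
have mulS s u : S s -> S u -> S (s * u)%g.
  move=> [m sm] [n un]; exists (maxn m n).+1.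
  have [-> _ _] := tP (maxn m n); rewrite mem_cat; apply/orP; right.
  apply/allpairsP; exists (s, u); split => //; rewrite in_cons; apply/orP; right.
    exact: incF (leq_maxl _ _) _ sm.
  exact: incF (leq_maxr _ _) _ un.
pose P : set W := closure (translations S).
have clP : closed P by exact: closed_closure.
have compP : comp_closed P by exact: closure_translations_comp.
have injP g : P g -> injective g.
  move=> Pg; apply: enveloping_injective => //.
  by apply: closure_subset Pg; apply: image_subset.
have [p [_ clp]] := @compact_selfmaps X (@phase_compact _ X) _ _
  (filterT : ((fun n => act (t n) : W) @ \oo) setT).
have near_p N (B : set W) : closed B -> (forall n, (N <= n)%N -> B (act (t n))) ->
    B p.
  move=> clB BN; apply: clB; move: clp; rewrite clusterE; apply.
  by exists N.
have Pp : P p.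
  apply: (near_p 0%N) => // n _; apply: subset_closure.
  by exists (t n).
(* A word [s] in [F n] sends [act2 (t m) z] into [A] for all [m >= n]; this passes to the cluster
   point [p] at the price of a closure. *)
have clAp s : S s -> closure A (act2 s (p z.1, p z.2)).
  move=> [n sn]; apply: (near_p n [set g : W | closure A (act2 s (g z.1, g z.2))]).
    apply: (@preimage_closed _ _ (fun g : W => act2 s (g z.1, g z.2))).
      move=> g _; apply: continuous_comp (@eval2_continuous z g) _.
      exact: act2_continuous.
    exact: closed_closure.
  move=> m nm; apply: subset_closure; have [_ _ At] := tP m.
  by apply: (At z); [case: (zO m.+1)|exact: incF sn].
have PclA : P `<=` [set q : W | closure A (q (p z.1), q (p z.2))].
  rewrite /P closureE; apply: smallest_sub.
    apply: (@preimage_closed _ _ (fun q : W => (q (p z.1), q (p z.2)))).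
      by move=> g _; exact: (@eval2_continuous (p z.1, p z.2)).
    exact: closed_closure.
  by move=> _ [s Ss <-]; exact: clAp.
have [q Pq qp] := comp_closed_linv (@phase_compact _ X) (@phase_hausdorff _ X)
  clP compP injP Pp.
have := PclA q Pq; have e x : q (p x) = x := congr1 (@^~ x) qp.
rewrite /= !e -surjective_pairing => /clA; apply.
by have := (zO 0%N).1; rewrite /O f0.
Qed.

End Enveloping.

(** * The Ellis group and its sigma-topology *)

Lemma compact_set_type (Z : topologicalType) (A : set Z) :
  compact A -> compact [set: A].
Proof.
move=> cA F PF _.
have [|z [Az clz]] := cA (set_val @ F) _.
  rewrite /fmap /=; apply: (@filterS _ F _ setT) => [a _|].
    exact: set_valP.
  exact: filterT.
exists (SigSub (mem_set Az)); split => // B C FB [_ [[V oV <-] Vz VC]].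
have FB' : (set_val @ F) (set_val @` B).
  by rewrite /fmap /=; apply: (@filterS _ F _ B) => // b Bb; exists b.
have [_ [[b Bb <-] Vb]] := clz _ _ FB' (open_nbhs_nbhs (conj oV Vz)).
by exists b; split => //; exact: VC.
Qed.

Section EllisGroup.
Context {T : monoidType} {X : semiflow T}.

(** The proof of distality is a parameter of the type because the group structure attached to the
    type uses it for inverses. *)
Definition ellis_group (dX : distal X) : Type := set_type (@enveloping T X).

HB.instance Definition _ (dX : distal X) :=
  Topological.copy (ellis_group dX) (set_type (@enveloping T X)).

Context (dX : distal X).
Local Notation G := (ellis_group dX).

Definition ev (g : G) : X -> X := set_val g.
Local Coercion ev : ellis_group >-> Funclass.

Lemma ev_enveloping (g : G) : enveloping (ev g).
Proof. exact: set_valP. Qed.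

Definition ellis_elt f (Ef : enveloping f) : G := SigSub (mem_set Ef).

Lemma ev_inj (f g : G) : (forall x, f x = g x) -> f = g.
Proof. by move=> fg; apply: val_inj; apply/funext. Qed.

Lemma translation_enveloping (t : T) : enveloping (act t : X -> X).
Proof. by apply: subset_closure; exists t. Qed.

Definition ellis_act (t : T) : G := ellis_elt (translation_enveloping (t := t)).

Let mul (f g : G) : G :=
  ellis_elt (@enveloping_comp T X _ _ (@ev_enveloping f) (@ev_enveloping g)).

Let one : G := ellis_act 1%g.

Let mulA : associative mul.
Proof. by move=> f g h; apply: ev_inj. Qed.

Let mul1 : left_id one mul.
Proof. by move=> f; apply: ev_inj => x; exact: act1. Qed.

Let mulr1 : right_id one mul.
Proof. by move=> f; apply: ev_inj => x; congr (ev f); exact: act1. Qed.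

Let ex_inv (g : G) : exists h : G, mul h g = one.
Proof.
have [//|h Eh hg] := comp_closed_linv (@phase_compact _ X) (@phase_hausdorff _ X)
  (@closed_closure _ _) (@enveloping_comp T X) _ (@ev_enveloping g).
  by move=> f; exact: enveloping_injective.
exists (ellis_elt Eh); apply: ev_inj => x.
by rewrite [RHS]act1; exact: (congr1 (@^~ x) hg).
Qed.

Let inv (g : G) : G := projT1 (cid (ex_inv g)).

Let mulV : left_inverse one inv mul.
Proof. by move=> g; exact: (projT2 (cid (ex_inv g))). Qed.

Let mulrV : right_inverse one inv mul.
Proof.
move=> g; have e : inv (inv g) = g.
  by rewrite -[LHS]mulr1 -(mulV g) mulA mulV mul1.
by rewrite -{1}e mulV.
Qed.

HB.instance Definition _ := isGroup.Build G mulA mul1 mulr1 mulV mulrV.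

Lemma evM (f g : G) x : ev (f * g)%g x = f (g x).
Proof. by []. Qed.

Lemma ev1 x : ev (1%g : G) x = x.
Proof. exact: act1. Qed.

Lemma compact_ellis : compact [set: G].
Proof.
apply: compact_set_type; apply: subclosed_compact (@closed_closure _ _) _ _.
  exact: (compact_selfmaps (@phase_compact _ X)).
by [].
Qed.

Lemma ev_continuous x : continuous (fun g : G => g x).
Proof.
move=> g; apply: (@continuous_comp G {ptws X -> X} X set_val (fun f => f x)).
  exact: initial_continuous.
exact: (@prod_eval_continuous X (fun=> X)).
Qed.

Lemma ev_pair_continuous x : continuous (fun z : G * G => (z.1 x, z.2 x)).
Proof.
by apply: (@map_pair_continuous _ _ _ _ (fun g : G => g x) (fun g : G => g x));
  exact: ev_continuous.
Qed.

Lemma ellis_mulr_continuous (h : G) : continuous (fun g : G => (g * h)%g).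
Proof.
apply: continuous_comp_initial => g.
apply: (@continuous_comp G {ptws X -> X} {ptws X -> X} set_val
  (fun f : {ptws X -> X} => f \o ev h : {ptws X -> X})).
  exact: initial_continuous.
exact: precomp_continuous.
Qed.

Lemma ellis_act_dense (g : G) (z : X * X) (O : set (X * X)) : open O ->
  O (g z.1, g z.2) -> exists t, O (act2 t z).
Proof.
move=> oO Oz; have [|_ [[t _ <-] Ot]] := @ev_enveloping g
    [set f | O (f z.1, f z.2)]; last by exists t.
by apply: (eval2_continuous (z := z)); exact: open_nbhs_nbhs.
Qed.

Lemma ellis_invariant (R : set (X * X)) (g : G) x y : closed R ->
  (forall t x y, R (x, y) -> R (act t x, act t y)) -> R (x, y) -> R (g x, g y).
Proof.
move=> clR invR Rxy; apply: contrapT.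
move=> /(@ellis_act_dense g (x, y) (~` R) (closed_openC clR))[t]; apply.
exact: invR.
Qed.

(** The orbit of [x] under [G] is closed, as a compact image, and contains the dense orbit under
    [T]. *)
Lemma ellis_transitive (mX : minimal_semiflow X) x y : exists g : G, g x = y.
Proof.
suff [g _ <-] : ((fun g : G => g x) @` setT) y by exists g.
have clI : closed ((fun g : G => g x) @` setT).
  apply: image_closed; [exact: compact_ellis|exact: phase_hausdorff| |exact: closedT].
  exact: ev_continuous.
apply: contrapT => ny; have [|z [nI [t _ tx]]] := mX x _ _ (closed_openC clI).
  by exists y.
by apply: nI; rewrite -tx; exists (ellis_act t).
Qed.

Definition ellis_div (z : G * G) : G := (z.1^-1 * z.2)%g.

Definition sigma_open (A : set G) : Prop := open (ellis_div @^-1` A).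

Lemma sigma_open_mulr (A : set G) (h : G) :
  sigma_open A -> sigma_open [set g | A (g * h)%g].
Proof.
move=> oA; rewrite /sigma_open (_ : _ @^-1` _ =
    (fun z : G * G => (z.1, (z.2 * h)%g)) @^-1` (ellis_div @^-1` A)).
  have : continuous (fun z : G * G => (z.1, (z.2 * h)%g)).
    apply: (@map_pair_continuous _ _ _ _ (fun g : G => g) (fun g : G => (g * h)%g)).
      by move=> ?; exact: cvg_id.
    exact: ellis_mulr_continuous.
  by move=> /continuousP; apply.
by apply/seteqP; split => z /=; rewrite /ellis_div /= mulgA.
Qed.

Lemma sigma_open_inv (A : set G) :
  sigma_open A -> sigma_open [set g | A g^-1%g].
Proof.
move=> oA; rewrite /sigma_open (_ : _ @^-1` _ =
    (fun z : G * G => (z.2, z.1)) @^-1` (ellis_div @^-1` A)).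
  by have /continuousP := @swap_continuous G G; apply.
by apply/seteqP; split => z /=; rewrite /ellis_div /= invgM invgK.
Qed.

(** Left translation is right translation conjugated by inversion. *)
Lemma sigma_open_mull (A : set G) (h : G) :
  sigma_open A -> sigma_open [set g | A (h * g)%g].
Proof.
move=> /sigma_open_inv/(@sigma_open_mulr _ h^-1%g)/sigma_open_inv.
congr sigma_open; apply/seteqP.
by split => g /=; rewrite invgM !invgK.
Qed.

(** Pulled back to [(y, z)], the condition says that some element of [G] moves [(y x, z x)] into
    [O]. By density of the translations some [t] then does so, and the pullback is a union over [t]
    of open sets. *)
Lemma sigma_open_orbit (x : X) (O : set (X * X)) : open O ->
  sigma_open [set a | exists g : G, O (g x, ev (g * a)%g x)].
Proof.
move=> oO; rewrite /sigma_open (_ : _ @^-1` _ = \bigcup_t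
    ((fun z : G * G => act2 t (z.1 x, z.2 x)) @^-1` O)).
  apply: bigcup_open => t _.
  have /continuousP : continuous (fun z : G * G => act2 t (z.1 x, z.2 x)).
    move=> z; apply: (@continuous_comp _ _ _ (fun z : G * G => (z.1 x, z.2 x))).
      exact: ev_pair_continuous.
    exact: act2_continuous.
  exact.
apply/seteqP; split => -[y z] /=; rewrite /ellis_div.
  move=> [g Og]; have [|t Ot] := @ellis_act_dense (g * y^-1)%g (y x, z x) O oO.
    rewrite /= -!evM -[in X in (_, ev X _)]mulgA.
    by rewrite -[(g * y^-1 * y)%g]mulgA mulVg mulg1.
  by exists t.
move=> [t _ Ot]; exists (ellis_act t * y)%g.
by rewrite -mulgA mulVKg !evM.
Qed.

(** * Elements of a subgroup not separated from the identity *)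

Section ClosureOfOne.
Variable L : set G.
Hypotheses (L1 : L 1%g) (LM : forall a b, L a -> L b -> L (a * b)%g)
  (LV : forall a, L a -> L a^-1%g).

Definition sigma_kernel : set G := [set m | L m /\
  forall A B, sigma_open A -> sigma_open B -> A 1%g -> B m ->
    exists u, [/\ A u, B u & L u]].

Lemma sigma_kernel1 : sigma_kernel 1%g.
Proof. by split => // A B _ _ A1 B1; exists 1%g. Qed.

(** First choose [u] in [L] with [u] in [A] and [u b] in [B]; after translation by [u], the
    non-separation of [b] from 1 yields [v] in [L] with [u v] in both sets. *)
Lemma sigma_kernelM a b :
  sigma_kernel a -> sigma_kernel b -> sigma_kernel (a * b)%g.
Proof.
move=> [La ka] [Lb kb]; split; first exact: LM.
move=> A B oA oB A1 Bab.
have [u [Au Bu Lu]] := ka _ _ oA (sigma_open_mulr (h := b) oB) A1 Bab.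
have [||v [Av Bv Lv]] := kb _ _ (sigma_open_mull (h := u) oA)
  (sigma_open_mull (h := u) oB).
- by rewrite /= mulg1.
- exact: Bu.
- by exists (u * v)%g; split => //; exact: LM.
Qed.

Lemma sigma_kernelV a : sigma_kernel a -> sigma_kernel a^-1%g.
Proof.
move=> [La ka]; split; first exact: LV.
move=> A B oA oB A1 Ba.
have [||u [Au Bu Lu]] := ka _ _ (sigma_open_inv oA) (sigma_open_inv oB).
- by rewrite /= invg1.
- by [].
- by exists u^-1%g; split => //; exact: LV.
Qed.

Lemma sigma_kernelJ a l :
  L l -> sigma_kernel a -> sigma_kernel (l * a * l^-1)%g.
Proof.
move=> Ll [La ka]; split; first by apply: LM; [exact: LM|exact: LV].
move=> A B oA oB A1 Ba.
have tr C : sigma_open C -> sigma_open [set g | C (l * g * l^-1)%g].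
  by move=> oC; exact: sigma_open_mull (sigma_open_mulr (h := l^-1%g) oC).
have [||u [Au Bu Lu]] := ka _ _ (tr _ oA) (tr _ oB).
- by rewrite /= mulg1 mulgV.
- exact: Ba.
- by exists (l * u * l^-1)%g; split => //; apply: LM; [exact: LM|exact: LV].
Qed.

(** If [A] and [B] separate 1 from one element of [L], the same pair serves all elements of [B],
    which gives an open neighbourhood outside the kernel. *)
Lemma closed_sigma_kernel :
  closed (ellis_div @^-1` L) -> closed (ellis_div @^-1` sigma_kernel).
Proof.
move=> clL; rewrite -[_ @^-1` _]setCK; apply: open_closedC.
rewrite openE => z /=; have [Lz|nLz] := pselect (L (ellis_div z)); last first.
  move=> _; apply: (@filterS _ (nbhs z) _ (~` (ellis_div @^-1` L))).
    by move=> w nLw [].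
  by apply: open_nbhs_nbhs; split => //; exact: closed_openC.
move=> nkz; have /existsNP[A /existsNP[B]] : ~ forall A B, sigma_open A ->
    sigma_open B -> A 1%g -> B (ellis_div z) -> exists u, [/\ A u, B u & L u].
  by move=> kz; apply: nkz.
move=> /not_implyP[oA /not_implyP[oB /not_implyP[A1 /not_implyP[Bz nu]]]].
apply: (@filterS _ (nbhs z) _ (ellis_div @^-1` B)).
  by move=> w Bw [_ kw]; apply: nu; exact: (kw A B).
exact: open_nbhs_nbhs.
Qed.

(** A separation of 1 from [a^-1 b] is translated by [a]. This is how the Hausdorff property of the
    coset space enters. *)
Lemma sigma_separation a b : L a -> L b -> ~ sigma_kernel (a^-1 * b)%g ->
  exists A B, [/\ sigma_open A, sigma_open B, A a, B b &
    forall u, A u -> B u -> ~ L u].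
Proof.
move=> La Lb nk.
have /existsNP[A /existsNP[B]] : ~ forall A B, sigma_open A ->
    sigma_open B -> A 1%g -> B (a^-1 * b)%g -> exists u, [/\ A u, B u & L u].
  by move=> k; apply: nk; split => //; apply: LM => //; exact: LV.
move=> /not_implyP[oA /not_implyP[oB /not_implyP[A1 /not_implyP[Bz nu]]]].
exists [set g | A (a^-1 * g)%g], [set g | B (a^-1 * g)%g]; split => //.
- exact: sigma_open_mull.
- exact: sigma_open_mull.
- by rewrite /= mulVg.
- move=> u Au Bu Lu; apply: nu; exists (a^-1 * u)%g; split => //.
  by apply: LM => //; exact: LV.
Qed.

End ClosureOfOne.

End EllisGroup.

(** * The successor of a closed invariant equivalence relation *)

Record is_icer (T : monoidType) (X : semiflow T) (R : set (X * X)) : Prop := IsIcer {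
  icer_closed : closed R;
  icer_refl : forall x, R (x, x);
  icer_sym : forall x y, R (x, y) -> R (y, x);
  icer_trans : forall x y z, R (x, y) -> R (y, z) -> R (x, z);
  icer_act : forall t x y, R (x, y) -> R (act t x, act t y)
}.

Section NextIcer.
Context {T : monoidType} {X : semiflow T} (dX : distal X).
Hypothesis mX : minimal_semiflow X.
Variable x0 : X.
Local Notation G := (ellis_group dX).
Local Coercion ev : ellis_group >-> Funclass.

Definition icer_group (R : set (X * X)) : set G := [set a | R (x0, a x0)].

Definition base_pair (z : G * G) : X * X := (z.1 x0, z.2 x0).

Definition next_icer (R : set (X * X)) : set (X * X) :=
  base_pair @` (@ellis_div _ _ dX @^-1` sigma_kernel (icer_group R)).

Lemma base_pair_surj z : exists p, base_pair p = z.
Proof.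
have [g gz] := ellis_transitive dX mX x0 z.1.
have [h hz] := ellis_transitive dX mX x0 z.2.
by exists (g, h); rewrite /base_pair /= gz hz -surjective_pairing.
Qed.

Section Fixed.
Variable R : set (X * X).
Hypothesis icR : is_icer R.
Local Notation L := (icer_group R).
Local Notation N := (sigma_kernel L).

Lemma icer_eval (g : G) x y : R (x, y) -> R (g x, g y).
Proof. by apply: ellis_invariant; [exact: icer_closed|exact: icer_act]. Qed.

Lemma icer_group_div (z : G * G) : L (ellis_div z) <-> R (base_pair z).
Proof.
rewrite /icer_group /base_pair /=; split => [/(icer_eval z.1)|/(icer_eval z.1^-1%g)];
  by rewrite -evM ?mulVKg // -evM mulVg ev1.
Qed.

Lemma icer_group1 : L 1%g.
Proof. by rewrite /icer_group /= ev1; exact: icer_refl. Qed.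

Lemma icer_groupM a b : L a -> L b -> L (a * b)%g.
Proof.
by move=> La Lb; apply: (icer_trans icR La); rewrite evM; exact: icer_eval.
Qed.

Lemma icer_groupV a : L a -> L a^-1%g.
Proof.
move=> /(icer_eval a^-1%g); rewrite -evM mulVg ev1.
exact: icer_sym.
Qed.

Lemma icer_group_stab (a : G) : a x0 = x0 -> L a.
Proof. by rewrite /icer_group /= => ->; exact: icer_refl. Qed.

Lemma closed_icer_group : closed (@ellis_div _ _ dX @^-1` L).
Proof.
rewrite (_ : _ @^-1` _ = base_pair @^-1` R).
  apply: preimage_closed; last exact: icer_closed.
  by move=> z _; exact: (@ev_pair_continuous _ _ dX x0).
by apply/seteqP; split => z /icer_group_div.
Qed.

(** The stabiliser of [x0] is contained in [L], which normalises [N]. This makes membership in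
    [next_icer] independent of the group elements chosen to represent the points. *)
Lemma kernel_conj_stab (n a : G) : N n -> a x0 = x0 ->
  exists2 m, N m & ev (a * n)%g x0 = m x0.
Proof.
move=> Nn ax; exists (a * n * a^-1)%g.
  apply: sigma_kernelJ => //.
  - exact: icer_groupM.
  - exact: icer_groupV.
  - exact: icer_group_stab.
have ax' : ev a^-1%g x0 = x0 by rewrite -{1}ax -evM mulVg ev1.
by rewrite [RHS]evM ax'.
Qed.

Lemma next_icerP (g h : G) : next_icer R (g x0, h x0) <->
  exists2 n, N n & h x0 = ev (g * n)%g x0.
Proof.
split=> [[[g' h'] /= Nn [gx hx]]|[n Nn hx]]; last first.
  by exists (g, g * n)%g; rewrite /ellis_div /base_pair /= ?mulKg // hx.
have ax : ev (g^-1 * g')%g x0 = x0 by rewrite evM gx -evM mulVg ev1.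
have [m Nm e] := kernel_conj_stab Nn ax; exists m => //.
by rewrite evM -e /ellis_div /= -evM !mulgA mulgV mul1g mulgV mul1g hx.
Qed.

Lemma next_icer_sub : next_icer R `<=` R.
Proof. by move=> _ [z [Lz _] <-]; apply/icer_group_div. Qed.

Lemma next_icer_is_icer : is_icer (next_icer R).
Proof.
split.
- apply: image_closed.
  + by apply: compact_pairT; exact: compact_ellis.
  + by apply: hausdorff_pair; exact: phase_hausdorff.
  + exact: (@ev_pair_continuous _ _ dX x0).
  + by apply: closed_sigma_kernel; exact: closed_icer_group.
- move=> x; have [g <-] := ellis_transitive dX mX x0 x.
  apply/next_icerP; exists 1%g; last by rewrite mulg1.
  by apply: sigma_kernel1; exact: icer_group1.
- move=> x y [[g h] /= Nn [<- <-]]; apply/next_icerP.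
  exists (h^-1 * g)%g; last by rewrite mulVKg.
  rewrite -[(h^-1 * g)%g]invgK invgM invgK.
  by apply: sigma_kernelV Nn; exact: icer_groupV.
- move=> x y z xy yz; move: xy yz.
  have [g <-] := ellis_transitive dX mX x0 x.
  have [h <-] := ellis_transitive dX mX x0 y.
  have [k <-] := ellis_transitive dX mX x0 z.
  move=> /next_icerP[n Nn hx] /next_icerP[m Nm kx].
  (* [h] and [g n] agree at [x0]; write [h = g n a] with [a] in the stabiliser and move [a] past [m]
     by normality. *)
  have ax : ev (n^-1 * g^-1 * h)%g x0 = x0.
    by rewrite evM hx -evM -mulgA mulKg mulVg ev1.
  have [m' Nm' e] := kernel_conj_stab Nm ax.
  apply/next_icerP; exists (n * m')%g.
    by apply: sigma_kernelM => //; exact: icer_groupM.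
  by rewrite mulgA evM -e kx -evM -!mulgA mulVKg mulVKg.
- move=> t x y [[g h] /= Nn [<- <-]].
  rewrite -[act t (g x0)]/(ev (ellis_act dX t * g)%g x0).
  rewrite -[act t (h x0)]/(ev (ellis_act dX t * h)%g x0).
  apply/next_icerP; exists (g^-1 * h)%g => //.
  by rewrite -mulgA mulVKg.
Qed.

(** Each pair of [R] is now some [(g x0, h x0)] with [g^-1 h] in [N]. Non-separation gives [u] in
    [L] such that the pair [(b x0, b u x0)] of [R] lies in [O] and is moved into [A] by [a b^-1],
    hence by some [t]; this is the density assumed by [distal_dense_diagonal]. *)
Lemma next_icer_proper : next_icer R = R -> forall x y, R (x, y) -> x = y.
Proof.
move=> nR; apply: (distal_dense_diagonal dX (icer_closed icR)).
move=> A O oA Adiag oO [z [Oz Rz]].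
move: Rz Oz; rewrite -{1}nR => -[[g h] /= [Ln kn] <-] Oz.
have [||u [[a Aa] [b Ob] Lu]] :=
    kn _ _ (sigma_open_orbit (dX := dX) (x := x0) oA)
      (sigma_open_orbit (dX := dX) (x := x0) oO).
- by exists 1%g; rewrite mulg1.
- by exists g; rewrite /ellis_div /= mulVKg.
have [|t At] := @ellis_act_dense _ _ dX (a * b^-1)%g (b x0, ev (b * u)%g x0) A oA.
  by rewrite /= -!evM mulgVK !mulgA mulgVK.
exists (b x0, ev (b * u)%g x0), t; split => //.
exact: icer_eval.
Qed.

(** The value [g^-1 h] does not change when [t] multiplies both [g] and [h] on the left. A bad pair
    near [z] thus shares its value with a pair of [R] outside [O], whereas separation of cosets and
    compactness keep the two kinds of values apart. *)
Lemma next_icer_equicontinuous (O : set (X * X)) :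
  (forall z, next_icer R z -> nbhs z O) ->
  forall z, next_icer R z ->
    \forall w \near z, R w -> forall t, O (act2 t w).
Proof.
move=> nO z nz; pose Bad := [set w | R w /\ exists t, ~ O (act2 t w)].
have cG2 : compact [set: G * G] by apply: compact_pairT; exact: compact_ellis.
have cbp : continuous base_pair := @ev_pair_continuous _ _ dX x0.
suff nclz : ~ closure Bad z.
  apply: (@filterS _ (nbhs z) _ (~` closure Bad)).
    move=> w nBw Rw t; apply: contrapT => nOw; apply: nBw.
    by apply: subset_closure; split => //; exists t.
  by apply: open_nbhs_nbhs; split => //; exact/closed_openC/closed_closure.
have -> : Bad = base_pair @` (base_pair @^-1` Bad).
  apply/seteqP; split=> [w Bw|_ [p Bp <-] //].
  by have [p pw] := base_pair_surj w; exists p => //; rewrite /preimage /= pw.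
move=> /(closure_imageS cG2 (hausdorff_pair (@phase_hausdorff _ X)
  (@phase_hausdorff _ X)) cbp)[[g h] clq qz].
(* [K] is the closure of the representatives of pairs of [R] outside [O]. As [O] is a neighbourhood
   of [next_icer R], the members of [K] represent pairs of [R] outside [next_icer R]. *)
pose K := closure [set p | R (base_pair p) /\ ~ O (base_pair p)].
have KP p : K p -> R (base_pair p) /\ ~ next_icer R (base_pair p).
  move=> Kp; split.
    have : closed (base_pair @^-1` R).
      by apply: preimage_closed; [move=> ? _; exact: cbp|exact: icer_closed].
    by apply; apply: closure_subset Kp => w [].
  by move=> /nO/cbp/Kp[w [[_ nOw] Ow]].
have /compact_near_coveringP/(_ _ (nbhs (g, h))
    (fun q p => ~ (ellis_div q = ellis_div p /\ L (ellis_div q)))) cK : compact K.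
  by apply: subclosed_compact cG2 _ => //; exact: closed_closure.
have [p Kp|w [Bw Kw]] := clq _ (cK _ _).
  have [Rp np] := KP p Kp.
  have [|||||A [B [oA oB Aq Bp AB]]] := @sigma_separation _ _ dX L _ _
      (ellis_div (g, h)) (ellis_div p).
  + exact: icer_groupM.
  + exact: icer_groupV.
  + by apply/icer_group_div/next_icer_sub; rewrite qz.
  + exact/icer_group_div.
  (* If both values lay in one coset of [N], then [p] would represent a pair of [next_icer R],
     because [z] is such a pair. *)
  + move=> Nlk; apply: np; move: nz; rewrite -qz => /next_icerP[n Nn hx].
    have ax : ev (n^-1 * g^-1 * h)%g x0 = x0.
      by rewrite evM hx -evM -mulgA mulKg mulVg ev1.
    have [m Nm e] := kernel_conj_stab Nlk ax.
    case: p {Kp Rp} Nlk e => p1 p2 Nlk e; apply/next_icerP; exists (n * m)%g.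
      by apply: sigma_kernelM => //; exact: icer_groupM.
    rewrite mulgA evM -e -evM; congr (ev _ x0).
    by rewrite /ellis_div /= invgM invgK -!mulgA !(mulVKg, mulKg).
  exists (@ellis_div _ _ dX @^-1` B, @ellis_div _ _ dX @^-1` A).
    by split; exact: open_nbhs_nbhs.
  by move=> [p' q'] [/= Bp' Aq'] [e Lq']; apply: (AB (ellis_div q')) => //; rewrite e.
move: Bw => [Rw [t nOt]].
have : K (ellis_act dX t * w.1, ellis_act dX t * w.2)%g.
  by apply: subset_closure; split => //; exact: (icer_act icR).
move=> /Kw; apply; split; first by rewrite /ellis_div /= invgM -mulgA mulKg.
exact/icer_group_div.
Qed.
End Fixed.
End NextIcer.

(** * Quotient semiflows *)

Lemma continuous_fst_comp (Z U V : topologicalType) (f : Z -> U * V) :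
  continuous f -> continuous (fun z => (f z).1).
Proof. by move=> cf z; apply: continuous_comp (cf z) _; exact: fst_continuous. Qed.

Lemma continuous_snd_comp (Z U V : topologicalType) (f : Z -> U * V) :
  continuous f -> continuous (fun z => (f z).2).
Proof. by move=> cf z; apply: continuous_comp (cf z) _; exact: snd_continuous. Qed.

(** * Uniform smallness around a closed relation *)

Section SmallEntourages.
Context {X : uniformType}.
Hypotheses (cX : compact [set: X]) (hX : hausdorff_space X).

(** Being near along this filter means being a small enough relation; it lets a compactness argument
    produce one entourage. *)
Definition small_sets : set_system (set (X * X)) :=
  filter_from entourage (fun W => [set V | V `<=` W]).

Global Instance small_sets_filter : Filter small_sets.
Proof.
apply: filter_from_filter; first by exists setT; exact: entourageT.
move=> A B eA eB; exists (A `&` B); first exact: filterI.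
by move=> V; rewrite /= subsetI.
Qed.

Lemma near_not_small (Z : topologicalType) (f g : Z -> X) (z : Z) :
  continuous f -> continuous g -> f z <> g z ->
  \forall w \near z & V \near small_sets, ~ V (f w, g w).
Proof.
move=> cf cg fg.
have [W entW nW] : exists2 W, entourage W & ~ W (f z, g z).
  apply: contrapT => nW; apply: fg; apply: hX.
  rewrite -closeEnbhs entourage_close => W entW.
  by apply: contrapT => nWz; apply: nW; exists W.
pose V := split_ent (split_ent W) `&` (split_ent (split_ent W))^-1%relation.
have entV : entourage V by apply: entourage_invI.
exists (f @^-1` xsection V (f z) `&` g @^-1` xsection V (g z),
    [set U | U `<=` V]).
  split; last by exists V.
  by apply: filterI; [apply: cf|apply: cg]; exact: nbhs_entourage.
move=> [w U] /= [[/xsectionP[fw _] /xsectionP[_ gw]] UV] /UV[fgw _].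
apply: nW; apply: (entourage_split (g w)) => //.
  exact: (entourage_split (f w)).
by apply: split_ent_subset.
Qed.

(** This prepares the splitting axiom for the uniformity of the quotient. At a point of the compact
    space of tuples where some [V]-link joins distinct points, the link fails nearby for small [V];
    where all links are equalities, transitivity gives [R (x, z)], so [O] holds nearby. *)
Lemma small_chain (R O : set (X * X)) : closed R ->
  (forall x y z, R (x, y) -> R (y, z) -> R (x, z)) ->
  (forall z, R z -> nbhs z O) ->
  exists2 V, entourage V & forall x b c y y' b' c' z,
    V (x, b) -> R (b, c) -> V (c, y) -> R (y, y') ->
    V (y', b') -> R (b', c') -> V (c', z) -> O (x, z).
Proof.
move=> clR trR nO.
have cR : compact R by apply: subclosed_compact (compact_pairT cX cX) _.
have cK := compact_setX (compact_pairT cX cX) (compact_setX cR (compact_setX cR cR)).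
have /compact_near_coveringP/(_ _ small_sets (fun V p =>
  V (p.1.1, p.2.1.1) -> V (p.2.1.2, p.2.2.1.1) -> V (p.2.2.1.2, p.2.2.2.1) ->
  V (p.2.2.2.2, p.1.2) -> O p.1)) := cK.
case=> [|W entW].
  move=> [[x z] [[b c] [[y y'] [b' c']]]] /= [_ [Rbc [Ry Rb']]].
  pose Z := ((X * X) * ((X * X) * ((X * X) * (X * X))))%type.
  have sep (f g : Z -> X) (p : Z) (P : set (X * X) -> Z -> Prop) :
      continuous f -> continuous g -> f p <> g p ->
      (forall V w, ~ V (f w, g w) -> P V w) ->
      \forall w \near p & V \near small_sets, P V w.
    move=> cf cg fg PV; apply: filterS (near_not_small cf cg fg) => -[w V] /=.
    exact: PV.
  have cid : continuous (@idfun Z) by move=> ?; exact: cvg_id.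
  have [xb|nxb] := pselect (x = b); last first.
    apply: (sep (fun p => p.1.1) (fun p => p.2.1.1)) => //.
    - exact: continuous_fst_comp (continuous_fst_comp cid).
    - exact: continuous_fst_comp (continuous_fst_comp (continuous_snd_comp cid)).
  have [cy|ncy] := pselect (c = y); last first.
    apply: (sep (fun p => p.2.1.2) (fun p => p.2.2.1.1)) => //.
    - exact: continuous_snd_comp (continuous_fst_comp (continuous_snd_comp cid)).
    - exact: continuous_fst_comp (continuous_fst_comp (continuous_snd_comp
        (continuous_snd_comp cid))).
  have [yb|nyb] := pselect (y' = b'); last first.
    apply: (sep (fun p => p.2.2.1.2) (fun p => p.2.2.2.1)) => //.
    - exact: continuous_snd_comp (continuous_fst_comp (continuous_snd_comp
        (continuous_snd_comp cid))).
    - exact: continuous_fst_comp (continuous_snd_comp (continuous_snd_comp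
        (continuous_snd_comp cid))).
  have [cz|ncz] := pselect (c' = z); last first.
    apply: (sep (fun p => p.2.2.2.2) (fun p => p.1.2)) => //.
    - exact: continuous_snd_comp (continuous_snd_comp (continuous_snd_comp
        (continuous_snd_comp cid))).
    - exact: continuous_snd_comp (continuous_fst_comp cid).
  have Rxz : R (x, z).
    rewrite xb -cz; apply: (trR) Rbc _; rewrite cy.
    by apply: (trR) Ry _; rewrite yb.
  exists (fst @^-1` O, setT); last by move=> [p V] [/= Op _] *.
  split; last exact: filterT.
  exact: (fst_continuous (x := ((x, z), _)) (nO _ Rxz)).
move=> WP; exists W => // x b c y y' b' c' z xb bc cy yy yb bcc cz.
exact: (WP W (@subset_refl _ W) ((x, z), ((b, c), ((y, y'), (b', c'))))).
Qed.

End SmallEntourages.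

Record icer (T : monoidType) (X : semiflow T) := Icer {
  icer_rel :> X * X -> Prop;
  icerP : is_icer icer_rel
}.

Section Quotient.
Context {T : monoidType} {X : semiflow T}.

Definition icer_quot (R : icer X) : Type :=
  {c : set X | exists x, c = [set y | R (x, y)]}.

HB.instance Definition _ (R : icer X) := gen_eqMixin (icer_quot R).
HB.instance Definition _ (R : icer X) := gen_choiceMixin (icer_quot R).

Context (R : icer X).
Local Notation Q := (icer_quot R).

Definition qproj (x : X) : Q := exist _ [set y | R (x, y)] (ex_intro _ x erefl).

Definition qrepr (u : Q) : X := projT1 (cid (svalP u)).

Lemma qreprK : cancel qrepr qproj.
Proof.
move=> [c hc]; rewrite /qrepr; case: cid => x /= xc.
exact: eq_exist.
Qed.

Lemma qprojP x y : qproj x = qproj y <-> R (x, y).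
Proof.
split=> [/(congr1 sval)/= xy|xy].
  have : [set z | R (y, z)] y by exact: (icer_refl (icerP R)).
  by rewrite -xy.
apply: eq_exist; apply/seteqP; split => z /=; apply: (icer_trans (icerP R)) => //.
exact: (icer_sym (icerP R)).
Qed.

Lemma qproj_repr x : R (x, qrepr (qproj x)).
Proof. by apply/qprojP; rewrite qreprK. Qed.

(* Entourages of [X / R] are the sets whose preimage is a neighbourhood of [R],
   not merely an entourage of [X]: the latter is too weak if the projection is
   not open. *)
Let ent : set_system (Q * Q) := [set E | forall z, R z ->
  nbhs z [set w | E (qproj w.1, qproj w.2)]].

Let ent_filter : Filter ent.
Proof.
split; first by move=> z _; exact: filterT.
  by move=> A B eA eB z Rz; exact: filterI (eA z Rz) (eB z Rz).
by move=> A B AB eA z Rz; apply: filterS (eA z Rz) => w; exact: AB.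
Qed.

Let ent_diag E : ent E -> (diagonal `<=` E)%relation.
Proof.
move=> eE [u v] /= uv; rewrite /diagonal /= in uv; rewrite -uv -(qreprK u).
by have /nbhs_singleton := eE _ (icer_refl (icerP R) (qrepr u)).
Qed.

Let ent_inv E : ent E -> ent E^-1%relation.
Proof.
move=> eE [x y] Rxy.
exact: (@swap_continuous X X (x, y) _ (eE (y, x) (icer_sym (icerP R) Rxy))).
Qed.

Let ent_split E : ent E -> exists2 B, ent B & (B \; B `<=` E)%relation.
Proof.
move=> eE.
have [V entV VE] := small_chain (@phase_compact _ X) (@phase_hausdorff _ X)
  (icer_closed (icerP R)) (icer_trans (icerP R)) eE.
pose W := V `&` V^-1%relation.
have entW : entourage W by exact: entourage_invI.
(* The half-size entourage is the image of the composite of [W], [R] and [W]; composing two of them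
   through representatives [y], [y'] of the middle class produces the chain of [small_chain]. *)
exists [set uv | exists x b c y, [/\ W (x, b), R (b, c), W (c, y),
  qproj x = uv.1 & qproj y = uv.2]].
  move=> [b c] Rbc; exists (xsection W b, xsection W c).
    by split; exact: nbhs_entourage.
  move=> [x y] /= [/xsectionP[Vx Vx'] /xsectionP Wy].
  by exists x, b, c, y; split => //; split.
move=> [u w] [v /= [x [b [c [y [[xb _] bc [cy _] /= <- yv]]]]]].
move=> [y' [b' [c' [z [[yb _] bc' [cz _] /= yv' <-]]]]].
by apply: (VE x b c y y' b' c' z) => //; apply/qprojP; rewrite yv yv'.
Qed.

HB.instance Definition _ :=
  isUniform.Build (icer_quot R) ent_filter ent_diag ent_inv ent_split.

Lemma quot_entourageE (E : set (Q * Q)) : entourage E <->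
  forall z, R z -> nbhs z [set w | E (qproj w.1, qproj w.2)].
Proof. by []. Qed.

Lemma qproj_continuous : continuous qproj.
Proof.
move=> x A; rewrite -[nbhs _ A]/(nbhs_ entourage _ A) => -[E eE EA].
have [[B C] [/= Bx Cx] BC] := eE _ (icer_refl (icerP R) x).
apply: filterS Cx => y Cy; apply/EA/xsectionP.
by apply: (BC (x, y)); split => //; exact: nbhs_singleton.
Qed.

Lemma quot_compact : compact [set: Q].
Proof.
have -> : [set: Q] = qproj @` setT.
  by apply/seteqP; split => // u _; exists (qrepr u) => //; exact: qreprK.
apply: continuous_compact; last exact: phase_compact.
exact/continuous_subspaceT/qproj_continuous.
Qed.

Lemma quot_hausdorff : hausdorff_space Q.
Proof.
move=> u v; rewrite -closeEnbhs entourage_close => uv; apply: contrapT => nuv.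
suff /uv : entourage (~` [set (u, v)]) by apply.
apply/quot_entourageE => z Rz.
pose C := [set w : X * X | R (w.1, qrepr u) /\ R (w.2, qrepr v)].
have clC : closed C.
  apply: closedI.
    apply: (@preimage_closed _ _ (fun w : X * X => (w.1, qrepr u))).
      move=> w _; apply: (pair_continuous (@fst_continuous X X)) => ?.
      exact: cvg_cst.
    exact: (icer_closed (icerP R)).
  apply: (@preimage_closed _ _ (fun w : X * X => (w.2, qrepr v))).
    move=> w _; apply: (pair_continuous (@snd_continuous X X)) => ?.
    exact: cvg_cst.
  exact: (icer_closed (icerP R)).
have nCz : ~ C z.
  case: z Rz => x y Rxy [/= /qprojP xu /qprojP yv]; apply: nuv.
  by rewrite -(qreprK u) -(qreprK v) -xu -yv; exact/qprojP.
apply: filterS (open_nbhs_nbhs (conj (closed_openC clC) nCz)) => w nCw /= [wu wv].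
by apply: nCw; split; apply/qprojP; rewrite qreprK.
Qed.

(** The projection is a closed map, from a compact to a Hausdorff space, so the uniform topology is
    the quotient topology. *)
Lemma quot_continuous (Z : topologicalType) (f : Q -> Z) :
  continuous (f \o qproj) -> continuous f.
Proof.
move=> /continuous_closedP cf; apply/continuous_closedP => C clC.
rewrite (_ : f @^-1` C = qproj @` ((f \o qproj) @^-1` C)).
  apply: image_closed; [exact: phase_compact|exact: quot_hausdorff| |exact: cf].
  exact: qproj_continuous.
apply/seteqP; split => [u Cu|_ [x Cx <-] //].
by exists (qrepr u); rewrite /= ?qreprK.
Qed.

Definition quot_act (t : T) (u : Q) : Q := qproj (act t (qrepr u)).

Lemma qproj_act t x : qproj (act t x) = quot_act t (qproj x).
Proof. by apply/qprojP; apply: (icer_act (icerP R)); exact: qproj_repr. Qed.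

Lemma quot_nonempty : [set: Q] !=set0.
Proof. by have [x _] := phase_nonempty X; exists (qproj x). Qed.

Lemma quot_act_continuous :
  continuous (fun p : discrete_topology T * Q => quot_act p.1 p.2).
Proof.
move=> [t u] A Au.
have ct : continuous (quot_act t).
  apply: quot_continuous => x; rewrite (_ : _ \o _ = qproj \o act t).
    apply: continuous_comp; first exact: act_cont.
    exact: qproj_continuous.
  by apply/funext => y; rewrite /= qproj_act.
exists ([set t], quot_act t @^-1` A).
  by split; [exact: (@discrete_set1 (discrete_topology T))|exact: ct].
by move=> [s v] [/= -> ].
Qed.

Lemma quot_act1 u : quot_act 1%g u = u.
Proof. by rewrite /quot_act act1 qreprK. Qed.

Lemma quot_actM t s u : quot_act t (quot_act s u) = quot_act (t * s)%g u.
Proof. by rewrite {2}/quot_act -qproj_act actM. Qed.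

Definition quot_semiflow : semiflow T :=
  @Semiflow T Q quot_act quot_nonempty quot_compact quot_hausdorff
    quot_act_continuous quot_act1 quot_actM.

Lemma quot_actE t x : act t (qproj x : quot_semiflow) = qproj (act t x).
Proof. by rewrite qproj_act. Qed.

Lemma quot_minimal : minimal_semiflow X -> minimal_semiflow quot_semiflow.
Proof.
move=> mX u O [v Ov] oO.
have [||x [Ox [t _ tx]]] := mX (qrepr u) (qproj @^-1` O).
- by exists (qrepr v); rewrite /= qreprK.
- by have /continuousP := qproj_continuous; apply.
- by exists (qproj x); split => //; exists t => //; rewrite -tx.
Qed.

End Quotient.

Section Bond.
Context {T : monoidType} {X : semiflow T}.
Implicit Types R S : icer X.

Definition qmap S R (u : quot_semiflow S) : quot_semiflow R := qproj R (qrepr u).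

Lemma qmap_proj S R x : icer_rel S `<=` R ->
  qmap R (qproj S x : quot_semiflow S) = qproj R x.
Proof. by move=> SR; apply/qprojP/(icer_sym (icerP R))/SR/qproj_repr. Qed.

Lemma qmap_epimorphism S R : icer_rel S `<=` R -> epimorphism (@qmap S R).
Proof.
move=> SR; split.
- apply: quot_continuous => x; rewrite (_ : _ \o _ = qproj R).
    exact: qproj_continuous.
  by apply/funext => y; exact: qmap_proj.
- by move=> u; exists (qproj S (qrepr u)); rewrite qmap_proj // qreprK.
- move=> t u; rewrite -[in LHS](qreprK u) quot_actE qmap_proj //.
  by rewrite -quot_actE.
Qed.

(** The [delta] taken is the largest possible one; the assumption, applied to the preimage of [E],
    makes it an entourage of the quotient. *)
Lemma qmap_equicontinuous S R : icer_rel S `<=` R ->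
  (forall O : set (X * X), (forall z, S z -> nbhs z O) ->
    forall z, S z -> \forall w \near z, R w -> forall t, O (act2 t w)) ->
  relatively_equicontinuous (@qmap S R).
Proof.
move=> SR eqR E entE.
exists [set w | qmap R w.1 = qmap R w.2 ->
    forall t, E (act t w.1, act t w.2)]; last by move=> x y; exact.
apply/quot_entourageE => z Sz.
apply: filterS (eqR _ entE z Sz) => w Ew /=.
rewrite !qmap_proj // => /qprojP Rw t.
by rewrite -!qproj_act; apply: Ew; rewrite -surjective_pairing in Rw.
Qed.

End Bond.

(** * Decreasing transfinite iteration *)

Section Tower.
Context {U : Type} (A0 : set U) (s : set U -> set U).
Hypothesis s_sub : forall A, s A `<=` A.

(** The least family closed under [s] and under intersections inside [A0]: the stages of the
    transfinite iteration of [s] from [A0], obtained without ordinals. The empty [F] gives [A0]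
    itself. *)
Inductive tower : set U -> Prop :=
| tower_step A : tower A -> tower (s A)
| tower_inter (F : set (set U)) :
    (forall A, F A -> tower A) -> tower (A0 `&` \bigcap_(A in F) A).

Lemma tower_sub A : tower A -> A `<=` A0.
Proof. by elim=> [B _ BA|F _ _]; [exact: subset_trans BA|exact: subIsetl]. Qed.

Lemma tower_start : tower A0.
Proof.
have : tower (A0 `&` \bigcap_(A in set0) A) by exact: tower_inter.
by rewrite bigcap_set0 setIT.
Qed.

(** The notion from the Bourbaki-Witt argument: [s] does not jump over an extreme [C]. All stages
    turn out to be extreme, which makes the tower a chain. *)
Let extreme C := forall A, tower A -> C `<=` A -> A <> C -> C `<=` s A.

Let extreme_comparable C : tower C -> extreme C ->
  forall A, tower A -> A `<=` s C \/ C `<=` A.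
Proof.
move=> tC eC A; elim=> [B tB [BC|CB]|F tF IH].
- by left; apply: subset_trans BC.
- have [->|nBC] := pselect (B = C); first by left.
  by right; exact: eC.
- have [[B FB BC]|nF] := pselect (exists2 B, F B & B `<=` s C).
    by left => x [_]; move/(_ B FB)/BC.
  right=> x Cx; split; first exact: tower_sub Cx.
  move=> B FB; case: (IH B FB) => [BC|]; last exact.
  by case: nF; exists B.
Qed.

Let tower_extreme C : tower C -> extreme C.
Proof.
elim=> [B tB eB|F tF eF] A tA CA nAC.
  case: (extreme_comparable tB eB tA) => [AB|BA].
    by case: nAC; apply/seteqP.
  have [AB|nAB] := pselect (A = B); first by rewrite AB.
  by apply: subset_trans (eB A tA BA nAB); exact: s_sub.
have [[B FB nBA]|allF] := pselect (exists2 B, F B & ~ A `<=` B); last first.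
  case: nAC; apply/seteqP; split => // x Ax; split; first exact: tower_sub Ax.
  by move=> B FB; apply: contrapT => nBx; apply: allF; exists B => // /(_ x Ax).
case: (extreme_comparable (tF B FB) (eF B FB) tA) => [AB|BA].
  by case: nBA; apply: subset_trans AB _; exact: s_sub.
move=> x [_ /(_ B FB)]; apply: eF => // AB; apply: nBA.
by rewrite AB.
Qed.

Lemma tower_comparable C A : tower C -> tower A -> A `<=` s C \/ C `<=` A.
Proof. by move=> tC tA; apply: extreme_comparable => //; exact: tower_extreme. Qed.

(** Induction over the tower: [s] cannot jump from a larger stage over [C], and it does not move
    [C], so the iteration stops there. *)
Lemma tower_fix_least C : tower C -> s C = C -> forall A, tower A -> C `<=` A.
Proof.
move=> tC sC A; elim=> [B tB CB|F tF IH x Cx].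
  by have [->|nBC] := pselect (B = C); [rewrite sC|exact: tower_extreme].
by split; [exact: tower_sub Cx|move=> B FB; exact: IH].
Qed.

(** The vacuous [let] makes [s_sub] a parameter of the type, so that order instances depending on it
    can be attached. *)
Definition tower_index : Type := let _ := s_sub in {A : set U | tower A}.

HB.instance Definition _ := gen_eqMixin tower_index.
HB.instance Definition _ := gen_choiceMixin tower_index.

Fact tower_display : Order.disp_t. Proof. exact: Order.Disp tt tt. Qed.

Let tower_le (la mu : tower_index) : bool := `[< sval mu `<=` sval la >].

Let tower_le_refl : reflexive tower_le.
Proof. by move=> la; apply/asboolP. Qed.

Let tower_le_anti : antisymmetric tower_le.
Proof.
move=> [A tA] [B tB] /andP[/asboolP BA /asboolP AB].
by apply: eq_exist; apply/seteqP.
Qed.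

Let tower_le_trans : transitive tower_le.
Proof.
by move=> la mu nu /asboolP lm /asboolP mn; apply/asboolP; exact: subset_trans lm.
Qed.

HB.instance Definition _ := Order.Le_isPOrder.Build tower_display tower_index
  tower_le_refl tower_le_anti tower_le_trans.

Lemma tower_leP (la mu : tower_index) :
  reflect (sval mu `<=` sval la) (la <= mu)%O.
Proof. exact: asboolP. Qed.

Let tower_le_total : total (<=%O : rel tower_index).
Proof.
move=> [A tA] [B tB]; case: (tower_comparable tA tB) => [BA|AB].
  by apply/orP; left; apply/tower_leP; exact: subset_trans (s_sub (A := A)).
by apply/orP; right; apply/tower_leP.
Qed.

HB.instance Definition _ := Order.POrder_isTotal.Build tower_display tower_index
  tower_le_total.

Let bot : tower_index := exist _ _ tower_start.

Let tower_le0 (la : tower_index) : (bot <= la)%O.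
Proof. by apply/tower_leP; exact: tower_sub (svalP la). Qed.

HB.instance Definition _ :=
  Order.hasBottom.Build tower_display tower_index tower_le0.

Let top : tower_index := exist _ _ (tower_inter (F := tower) (fun A tA => tA)).

Let tower_le1 (la : tower_index) : (la <= top)%O.
Proof. by apply/tower_leP => x [_]; apply; exact: svalP la. Qed.

HB.instance Definition _ :=
  Order.hasTop.Build tower_display tower_index tower_le1.

Lemma tower_topE : s (sval (\top%O : tower_index)) = sval (\top%O : tower_index).
Proof.
apply/seteqP; split; first exact: s_sub.
move=> x [_]; apply; apply: tower_step; exact: svalP (\top%O : tower_index).
Qed.

Definition tower_next (la : tower_index) : tower_index :=
  exist _ _ (tower_step (svalP la)).

Lemma tower_ltP (la mu : tower_index) :
  (la < mu)%O <-> sval mu `<=` sval la /\ sval mu <> sval la.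
Proof.
rewrite lt_def; split => [/andP[/eqP ne /tower_leP ml]|[ml ne]].
  split => // e; apply: ne; apply/eqP; rewrite eq_le.
  by apply/andP; split; apply/tower_leP; rewrite e.
by apply/andP; split; [apply/eqP => e; apply: ne; rewrite e|apply/tower_leP].
Qed.

Lemma tower_next_least (la mu : tower_index) :
  (la < mu)%O -> (tower_next la <= mu)%O.
Proof.
move=> /tower_ltP[ml ne]; apply/tower_leP.
by case: (tower_comparable (svalP la) (svalP mu)) => // lm; case: ne; apply/seteqP.
Qed.

Lemma tower_lt_next (la mu : tower_index) :
  (la < mu)%O -> (la < tower_next la)%O.
Proof.
move=> /tower_ltP[ml ne]; apply/tower_ltP; split; first exact: s_sub.
move=> e; apply: ne; apply/seteqP; split => //.
by apply: tower_fix_least e _ _; exact: svalP.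
Qed.

Lemma tower_successor (la mu : tower_index) :
  is_successor la mu -> mu = tower_next la.
Proof.
move=> [lm least]; apply/eqP; rewrite eq_le.
by rewrite tower_next_least // least //; exact: tower_lt_next lm.
Qed.

(** The intersection [c] of the earlier stages contains [mu]. Were it strictly larger, [c] would
    come before [mu], and [mu] would be its successor, since a [tower_next c] before [mu] would have
    to contain [c]. *)
Lemma tower_limit (mu : tower_index) : is_limit mu ->
  A0 `&` \bigcap_(A in [set sval la | la in [set la | (la < mu)%O]]) A = sval mu.
Proof.
move=> [_ nsucc]; set F := mkset _; set C := A0 `&` _.
have tC : tower C by apply: tower_inter => _ [la _ <-]; exact: svalP.
pose c : tower_index := exist _ C tC.
have muC : sval mu `<=` C.
  move=> x mux; split; first exact: tower_sub (svalP mu) _ mux.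
  by move=> _ [la /= /tower_ltP[ml _] <-]; exact: ml.
apply: contrapT => nC; have lt_c : (c < mu)%O by apply/tower_ltP; split => // /esym.
apply: nsucc; exists c; split => // k ck; apply: le_trans (tower_next_least ck).
rewrite leNgt; apply/negP => lt_mu.
have /tower_ltP[_] := tower_lt_next lt_c; apply; apply/seteqP; split.
  exact: s_sub.
by move=> x [_]; apply; exists (tower_next c).
Qed.

(** The least element of [P] is the intersection [c] of all stages containing every member of [P].
    If [c] were not in [P], then [tower_next c] would be another such stage and so contain [c],
    although it is strictly smaller. *)
Lemma tower_well_order : well_order (fun la mu : tower_index => (la <= mu)%O).
Proof.
apply: antisymmetric_well_order; first exact: tower_le_anti.
move=> P [la0 Pla0].
pose F := [set A | tower A /\ forall la, la \in P -> sval la `<=` A].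
have tC : tower (A0 `&` \bigcap_(A in F) A) by apply: tower_inter => A [].
pose c : tower_index := exist _ _ tC.
have c_lb la : la \in P -> (c <= la)%O.
  move=> Pla; apply/tower_leP => x lax; split; first exact: tower_sub (svalP la) _ lax.
  by move=> A [_ /(_ _ Pla) laA]; exact: laA.
exists c; split; last exact: c_lb.
apply: contrapT => nPc.
have lt_c la : la \in P -> (c < la)%O.
  move=> Pla; rewrite lt_neqAle c_lb // andbT.
  by apply/eqP => e; apply: nPc; rewrite e.
have /tower_ltP[_] := tower_lt_next (lt_c _ Pla0); apply; apply/seteqP; split.
  exact: s_sub.
move=> x [_]; apply; split; first exact: tower_step.
by move=> la Pla; apply/tower_leP; apply: tower_next_least; exact: lt_c.
Qed.

End Tower.

(** * The tower of a homomorphism *)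

Lemma injective_hausdorff (Z W : topologicalType) (f : Z -> W) :
  hausdorff_space W -> continuous f -> injective f -> hausdorff_space Z.
Proof.
move=> hW cf injf x y xy; apply/injf/hW => A B /cf Ax /cf By.
by have [z [Az Bz]] := xy _ _ Ax By; exists (f z).
Qed.

Lemma qmap_comp (T : monoidType) (X : semiflow T) (R S Q : icer X)
    (u : quot_semiflow Q) : icer_rel S `<=` R ->
  qmap R u = qmap R (qmap S u).
Proof. by move=> SR; rewrite [in RHS]/qmap -/(qmap R _) qmap_proj. Qed.

(** * Projective systems of quotients *)

Section QuotientSystem.
Context {T : monoidType} {X : semiflow T} {d : Order.disp_t} {I : tbOrderType d}.
Variable R : I -> icer X.
Hypothesis decR : forall nu la : I, (nu < la)%O -> icer_rel (R la) `<=` R nu.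
Hypothesis limR : forall mu : I, is_limit mu ->
  forall z, (forall la, (la < mu)%O -> R la z) -> R mu z.

Let stage (la : I) : semiflow T := quot_semiflow (R la).

Let bond (nu la : I) (h : (nu < la)%O) : stage la -> stage nu := qmap (R nu).

(** The map to threads is a continuous bijection from a compact to a Hausdorff space. [limR] gives
    injectivity; a thread is attained because its coordinates form a decreasing chain of nonempty
    closed classes in [X]. *)
Let bond_lim (mu : I) : is_limit mu -> is_inverse_limit bond mu.
Proof.
move=> lim_mu.
have thr (u : stage mu) :
    threads bond (fun la : below mu => qmap (R (sval la)) u).
  by move=> nu la h /=; rewrite /bond -qmap_comp //; exact: decR.
pose h (u : stage mu) : @threads T d I stage bond mu := SigSub (mem_set (thr u)).
have cont_h : continuous h.
  apply: continuous_comp_initial; apply: prod_topology_continuous => la.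
  by have [] := qmap_epimorphism (decR (svalP la)).
have inj_h : injective h.
  move=> u v huv; rewrite -(qreprK u) -(qreprK v); apply/qprojP.
  apply: limR => // la lm; apply/qprojP.
  by have := congr1 (fun x => set_val x (exist (fun la => (la < mu)%O) la lm)) huv.
have surj_h x : exists u, h u = x.
  have [z zx] : exists z, forall la : below mu, qproj (R (sval la)) z = set_val x la.
    pose C (la : below mu) := [set z | qproj (R (sval la)) z = set_val x la].
    have clC la : closed (C la).
      apply: (@preimage_closed _ _ (qproj (R (sval la))) [set set_val x la]).
        by move=> ? _; exact: qproj_continuous.
      apply: accessible_closed_set1; apply: hausdorff_accessible.
      exact: quot_hausdorff.
    have bot_lt : (\bot < mu)%O.
      by rewrite lt0x; apply/eqP; case: lim_mu.
    have subC (nu la : below mu) : (sval nu < sval la)%O -> C la `<=` C nu.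
      move=> lt_nl z Cz; apply: etrans (esym (set_valP x nu la lt_nl)).
      rewrite -[X in bond _ X]Cz; apply/esym/qmap_proj; exact: decR.
    have [||||z zC] := @compact_chain_inter _ (range C) (@phase_compact _ X).
    - pose b : below mu := exist (fun la => (la < mu)%O) _ bot_lt.
      by exists (C b), b.
    - move=> _ _ [la _ <-] [nu _ <-].
      have [lt_ln|lt_nl|e] := ltgtP (sval la) (sval nu).
      + by right; exact: subC.
      + by left; exact: subC.
      + by left; have -> : la = nu by exact: val_inj.
    - by move=> _ [la _ <-].
    - move=> _ [la _ <-]; exists (qrepr (set_val x la)).
      exact: qreprK.
    by exists z => la; apply: (zC (C la)); exists la.
  exists (qproj (R mu) z); apply/val_inj/functional_extensionality_dep => la.
  rewrite -[RHS]zx; apply: qmap_proj; exact: decR (svalP la).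
have [g gK] := choice surj_h.
have hK : cancel h g by move=> u; apply: inj_h; rewrite gK.
exists h; split => //.
- split => //; exists g; split => //.
  apply: cancel_continuous hK gK => //; first exact: quot_compact.
  apply: (@injective_hausdorff _ (product_below stage mu) set_val); last exact: val_inj.
    by apply: hausdorff_prodT => la; exact: quot_hausdorff.
  exact: initial_continuous.
- move=> t u; apply/functional_extensionality_dep => la.
  by have [_ _] := qmap_epimorphism (decR (svalP la)); apply.
Qed.

Definition quotient_system (mX : minimal_semiflow X) : projective_system T I :=
  @ProjectiveSystem T d I stage bond (fun la => quot_minimal (R := R la) mX)
    (fun nu la h => qmap_epimorphism (decR h))
    (fun nu la eta h1 h2 h3 x => qmap_comp x (decR h1)) bond_lim.

End QuotientSystem.

(** * The tower from the kernel down to the diagonal *)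

Section KernelTower.
Context {T : monoidType} {X Y : semiflow T} (p : X -> Y).
Hypotheses (dX : distal X) (mX : minimal_semiflow X) (epi_p : epimorphism p).
Variable x0 : X.
Local Notation U := (option (X * X)).

(* Relations are coded as subsets of [option (X * X)]; the extra point [None]
   belongs to the bottom of the tower only, so that the tower has at least two
   stages even if [p] is injective. *)
Definition coded (A : set U) : set (X * X) := [set z | A (Some z)].

Definition kernel_start : set U :=
  [set o | if o is Some z then p z.1 = p z.2 else True].

(** The first step only removes [None], so stages 0 and 1 carry the same relation; every later step
    applies [next_icer]. *)
Definition kernel_next (A : set U) : set U := [set o | if o is Some z then
  A o /\ (A None \/ next_icer dX x0 (coded A) z) else False].

Lemma kernel_next_sub A : kernel_next A `<=` A.
Proof. by move=> [z []|]. Qed.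

Local Notation I := (tower_index kernel_start kernel_next_sub).

Lemma kernel_is_icer : is_icer (coded kernel_start).
Proof.
have [cp _ eqp] := epi_p; split=> //=.
- apply: (@preimage_closed _ _ (fun z => (p z.1, p z.2)) [set z | z.1 = z.2]).
    by have cpp := map_pair_continuous cp cp; move=> z _; exact: cpp.
  by apply: closed_diagonal; exact: phase_hausdorff.
- by move=> x y z; rewrite /coded /= => ->.
- by move=> t x y; rewrite /coded /= !eqp => ->.
Qed.

Lemma coded_next A : is_icer (coded A) -> coded (kernel_next A) =
  if pselect (A None) then coded A else next_icer dX x0 (coded A).
Proof.
move=> icA; case: pselect => AN; apply/seteqP; split=> z.
- by case.
- by move=> Az; split => //; left.
- by case=> _ [].
- by move=> nz; split; [exact: (next_icer_sub icA nz)|right].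
Qed.

Lemma coded_is_icer A : tower kernel_start kernel_next A -> is_icer (coded A).
Proof.
elim=> [B _ icB|F _ icF].
  by rewrite coded_next //; case: pselect => BN //=; exact: next_icer_is_icer.
have icK := kernel_is_icer.
have cE : coded (kernel_start `&` \bigcap_(A in F) A) =
    coded kernel_start `&` \bigcap_(A in F) coded A by [].
split.
- rewrite cE; apply: closedI; first exact: icer_closed icK.
  by apply: closed_bigI => B FB; exact: icer_closed (icF B FB).
- by move=> x; split => [//|B FB]; exact: icer_refl (icF B FB) x.
- move=> x y [Kxy Fxy]; split; first exact: (icer_sym icK Kxy).
  by move=> B FB; apply: (icer_sym (icF B FB)); exact: Fxy.
- move=> x y z [Kxy Fxy] [Kyz Fyz]; split; first exact: (icer_trans icK Kxy Kyz).
  by move=> B FB; apply: (icer_trans (icF B FB) (Fxy B FB)); exact: Fyz.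
- move=> t x y [Kxy Fxy]; split; first exact: (icer_act icK t Kxy).
  by move=> B FB; apply: (icer_act (icF B FB)); exact: Fxy.
Qed.

Definition kernel_icer (la : I) : icer X := Icer (coded_is_icer (svalP la)).

Lemma kernel_icer_dec (nu la : I) :
  (nu < la)%O -> icer_rel (kernel_icer la) `<=` kernel_icer nu.
Proof. by move=> /tower_ltP[ln _] z; exact: ln. Qed.

Lemma kernel_icer_lim (mu : I) : is_limit mu ->
  forall z, (forall la, (la < mu)%O -> kernel_icer la z) -> kernel_icer mu z.
Proof.
move=> lim_mu z zla; rewrite /kernel_icer /coded /= -(tower_limit lim_mu).
split; last by move=> _ [la /= lm <-]; exact: zla.
by apply: (zla \bot%O); rewrite lt0x; apply/eqP; case: lim_mu.
Qed.

(** The top is a fixed point of [kernel_next], hence free of [None], so its relation is fixed by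
    [next_icer] and [next_icer_proper] applies. *)
Lemma kernel_icer_top z : kernel_icer \top%O z -> z.1 = z.2.
Proof.
have e := @tower_topE _ kernel_start _ kernel_next_sub.
set M := sval _ in e.
have nMN : ~ M None by rewrite -e.
have icM : is_icer (coded M) := icerP (kernel_icer \top%O).
have nM : next_icer dX x0 (coded M) = coded M.
  by have := coded_next icM; rewrite e; case: pselect.
by case: z => x y Mxy; apply: (next_icer_proper icM nM); exact: Mxy.
Qed.

Lemma kernel_bot_lt_top : (\bot < \top :> I)%O.
Proof.
apply/tower_ltP; split.
  exact: (@tower_sub _ _ _ kernel_next_sub _ (svalP (\top%O : I))).
move=> e; have : sval (\top%O : I) None by rewrite e.
by rewrite -tower_topE.
Qed.

Lemma kernel_icer_equicontinuous (la : I) :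
  relatively_equicontinuous
    (@qmap _ X (kernel_icer (tower_next la)) (kernel_icer la)).
Proof.
apply: qmap_equicontinuous; first by move=> z [].
have icA : is_icer (coded (sval la)) := icerP (kernel_icer la).
rewrite /kernel_icer /= coded_next //; case: pselect => AN /=.
  (* At the first step the relation is unchanged: orbits of its pairs stay in it, and so in [O]. *)
  move=> O nO z _; apply: filterE => w Rw t; apply: nbhs_singleton; apply: nO.
  by case: w Rw => x y; exact: (icer_act icA).
exact: next_icer_equicontinuous.
Qed.

End KernelTower.

Theorem theorem6p14 (T : monoidType) (X Y : semiflow T) (p : X -> Y)
    (distalX : distal X) (minimalX : minimal_semiflow X)
    (distalY : distal Y) (minimalY : minimal_semiflow Y)
    (epi_p : epimorphism p) :
  exists (d : Order.disp_t) (I : tbOrderType d) (bot_lt_top : (\bot < \top :> I)%O)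
         (S : projective_system T I)
         (hX : S \top%O -> X) (hY : S \bot%O -> Y),
    [/\ well_order (fun x y : I => (x <= y)%O),
        isomorphism hX,
        isomorphism hY,
        forall x : S \top%O, hY (bond bot_lt_top x) = p (hX x) &
        forall (la la' : I) (h : (la < la')%O), is_successor la la' ->
          relatively_equicontinuous (bond (p := S) h)].
Proof.
have [x0 _] := phase_nonempty X.
have [cp sp eqp] := epi_p.
pose I : tbOrderType tower_display :=
  tower_index (kernel_start p) (kernel_next_sub (dX := distalX) (x0 := x0)).
pose R : I -> icer X := kernel_icer minimalX epi_p (x0 := x0).
have decR : forall nu la : I, (nu < la)%O -> icer_rel (R la) `<=` R nu.
  exact: kernel_icer_dec.
pose S : projective_system T I := quotient_system decR
  (@kernel_icer_lim _ _ _ _ distalX minimalX epi_p x0) minimalX.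
have reprK : cancel (qproj (R \top%O)) (@qrepr _ _ (R \top%O)).
  by move=> x; apply/esym; exact: (kernel_icer_top (qproj_repr (R \top%O) x)).
have p_repr x : p (qrepr (qproj (R \bot%O) x)) = p x.
  by have := qproj_repr (R \bot%O) x.
(* [hX] chooses representatives, which are unique as the top relation is the diagonal; [hY] is the
   map induced by [p], the bottom relation being the kernel of [p]. *)
exists tower_display, I, (kernel_bot_lt_top p distalX x0), S,
  (@qrepr _ _ (R \top%O)), (p \o @qrepr _ _ (R \bot%O)); split.
- exact: tower_well_order.
- split; last by move=> t u; rewrite [LHS]reprK.
  split; last first.
    by exists (qproj (R \top%O)); split; [exact: qproj_continuous|exact: qreprK|].
  apply: quot_continuous; rewrite (_ : _ \o _ = id); first by move=> x; exact: cvg_id.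
  by apply/funext.
- split; last by move=> t u; rewrite /= p_repr eqp.
  have [s sK] := choice sp.
  have c_hY : continuous (p \o @qrepr _ _ (R \bot%O)).
    apply: quot_continuous; rewrite (_ : _ \o _ = p) //.
    exact/funext.
  have gK : cancel (p \o @qrepr _ _ (R \bot%O)) (qproj (R \bot%O) \o s).
    move=> u; rewrite /= -[RHS]qreprK; apply/qprojP.
    by rewrite /R /= /coded /= sK.
  have Kg : cancel (qproj (R \bot%O) \o s) (p \o @qrepr _ _ (R \bot%O)).
    by move=> y; rewrite /= p_repr.
  split => //; exists (qproj (R \bot%O) \o s); split => //.
  apply: cancel_continuous gK Kg => //; first exact: quot_compact.
  exact: phase_hausdorff.
- by move=> x; exact: p_repr.
- move=> la la' h succ; move: h; rewrite (tower_successor succ) => h.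
  exact: kernel_icer_equicontinuous.
Qed.
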